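(* Let $X$ be a non-empty complete metric space, let $f\colon X\to\mathbb{R}$, and let $\Sigma=\mathrm{CLO}(X)$ be the family of all closed subsets of $X$ possessing non-empty interior. Then the game $G_1(\Sigma,f)$ is determined, and - if $f$ is cliquish, then Player II has a winning strategy in the game $G_1(\Sigma,f)$; - if $f$ is not cliquish, then Player I has a winning strategy in the game $G_1(\Sigma,f)$.
   Context: A function $f\colon X\to\mathbb{R}$ is cliquish if for each non-empty open set $W\subseteq X$ and each $\varepsilon>0$ there is a non-empty open set $U\subseteq W$ with $\operatorname{diam}(f(U))<\varepsilon$. The game $G_1(\Sigma,f)$, for a non-empty family $\Sigma$ of non-empty subsets of $X$ and $f\colon X\to\mathbb{R}$: Player I plays $P\in\Sigma$, Player II plays $P_0$; then at the $n$th step ($n\ge1$) Player I plays a point $x_n$ and Player II plays a set $P_n$. The rules are: $P_n\in\Sigma$ and $P_n\subseteq P$ for all $n\ge0$ (the $P_n$ need not be decreasing), and $x_{n+1}\in P_n$ for all $n\ge 0$. Player II wins if $\langle x_n\rangle$ converges in $X$ and $\lim_{n}f(x_n)=f(\lim_{n}x_n)$; otherwise Player I wins. The game is determined if one of the players has a winning strategy. *)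

(* Defs.v *)
From HB Require Import structures.
From mathcomp Require Import all_boot all_order all_algebra.
From mathcomp Require Import all_classical all_reals all_analysis.

Set Implicit Arguments.
Unset Strict Implicit.
Unset Printing Implicit Defensive.

Import Order.TTheory GRing.Theory Num.Theory.
Import numFieldNormedType.Exports.

Local Open Scope classical_set_scope.
Local Open Scope ring_scope.

(* [metricType] carries no completeness axiom, and the completeness structure
   of the library is only joined with pseudometric spaces. *)
Definition complete_metric (R : realType) (X : metricType R) : Prop :=
  forall u : nat -> X, cauchy (u @ \oo) -> exists l : X, u @ \oo --> l.

Definition diam (R : realType) (A : set R) : \bar R :=
  ereal_sup [set (`|p.1 - p.2|)%:E | p in A `*` A].

Definition cliquish (R : realType) (X : topologicalType) (f : X -> R) : Prop :=
  forall (W : set X) (e : R), open W -> W !=set0 -> 0 < e ->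
    exists U : set X,
      [/\ open U, U !=set0, U `<=` W & (diam (f @` U) < e%:E)%E].

Definition CLO (X : topologicalType) : set (set X) :=
  [set A | closed A /\ (interior A) !=set0].

(* The game G_1(Sigma, f).  A run is given by the opening move [P] of Player I,
   the moves [Q 0, Q 1, ...] of Player II and the points played by Player I;
   these points are numbered from 1 in the usual description of the game and
   from 0 here, so that the order of the moves is
     P, Q 0, x 0, Q 1, x 1, Q 2, ...
   The family [Sigma] is meant to be non-empty with non-empty members, so that
   a player can always make a legal move. *)
Section Game.
Variables (R : realType) (X : topologicalType).
Variables (Sigma : set (set X)) (f : X -> R).

Definition legalII (P : set X) (Q : nat -> set X) (n : nat) : Prop :=
  Sigma (Q n) /\ Q n `<=` P.

Definition legalI (Q : nat -> set X) (x : nat -> X) (n : nat) : Prop :=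
  Q n (x n).

Definition payoffII (x : nat -> X) : Prop :=
  exists l : X, x @ \oo --> l /\ f \o x @ \oo --> f l.

(* A strategy maps the moves made so far by the opponent to the next move.
   It is winning if, against every opponent, it never is the first to break the
   rules, and wins every run in which the opponent respects the rules. *)

Definition winning_strategyI (P : set X) (s : seq (set X) -> X) : Prop :=
  Sigma P /\
  forall Q : nat -> set X,
    let x := fun n => s (mkseq Q n.+1) in
    (forall n, (forall k, (k <= n)%N -> legalII P Q k) -> legalI Q x n) /\
    ((forall n, legalII P Q n) -> ~ payoffII x).

Definition winning_strategyII (t : set X -> seq X -> set X) : Prop :=
  forall (P : set X) (x : nat -> X), Sigma P ->
    let Q := fun n => t P (mkseq x n) in
    (forall n, (forall k, (k < n)%N -> legalI Q x k) -> legalII P Q n) /\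
    ((forall n, legalI Q x n) -> payoffII x).

Definition I_has_winning_strategy : Prop :=
  exists (P : set X) (s : seq (set X) -> X), winning_strategyI P s.

Definition II_has_winning_strategy : Prop :=
  exists t : set X -> seq X -> set X, winning_strategyII t.

Definition determined : Prop :=
  I_has_winning_strategy \/ II_has_winning_strategy.

End Game.

(* Main.v *)
Require Import Defs.
From mathcomp Require Import all_boot all_order all_algebra.
From mathcomp Require Import all_classical all_reals all_analysis.
From mathcomp Require Import lra.

Import Order.TTheory GRing.Theory Num.Theory.
Import numFieldNormedType.Exports.

Local Open Scope classical_set_scope.
Local Open Scope ring_scope.

(** Both strategies rest on reading the definition of cliquishness inside the
    sets that Player II may play.

    If [f] is cliquish, Player II shrinks: every closed set with non-empty
    interior contains another one in which any two points are at distance less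
    than [e] and have values less than [e] apart ([cliquish_CLO_shrink]).
    Iterating this with [e = 1/(n+1)] gives a decreasing sequence of moves,
    chosen regardless of the points that Player I plays.  Whatever points Player I picks in these sets form a
    Cauchy sequence; by completeness it converges, its limit lies in every set
    of the sequence since they are closed, and so the small oscillation of [f]
    on them makes the values converge to the value at the limit
    ([payoffII_shrinking]).

    If [f] is not cliquish, there are a non-empty open set [W] and [e > 0] such
    that [f] oscillates by at least [e] on each non-empty open subset of [W].
    Player I opens with a closed set inside [W].  Every answer of Player II then
    contains points at which [f] is farther than [e/3] from any prescribed real
    number ([oscillation_far_value]), and Player I always picks a point whose
    value is farther than [e/3] from the value at the point picked just before.
    The values are not Cauchy, hence Player II loses whether or not the points
    converge.

    Determinacy follows, since [f] is either cliquish or not. *)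

Lemma diam_image_dist (R : realType) (T : Type) (f : T -> R) (A : set T)
    (e : R) (a b : T) :
  (diam (f @` A) < e%:E)%E -> A a -> A b -> `|f a - f b| < e.
Proof.
move=> Ae Aa Ab; rewrite -lte_fin; apply: le_lt_trans Ae.
by apply: ereal_sup_ubound; exists (f a, f b) => //; split; apply: imageP.
Qed.

(** If all values were within [e/3] of [y], the oscillation would be at most
    [2e/3]. *)
Lemma oscillation_far_value (R : realType) (T : Type) (f : T -> R) (A : set T)
    (e y : R) :
  0 < e -> ~ (diam (f @` A) < e%:E)%E -> exists2 a, A a & e / 3 < `|f a - y|.
Proof.
move=> e0 Ae; apply: contrapT => near_y; apply: Ae.
have le_y a : A a -> `|f a - y| <= e / 3.
  by move=> Aa; rewrite leNgt; apply/negP => lt_y; apply: near_y; exists a.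
apply: (@le_lt_trans _ _ (e / 3 + e / 3)%:E); last by rewrite lte_fin; lra.
apply: ge_ereal_sup => _ [[_ _] [[a Aa <-] [b Ab <-]] <-] /=; rewrite lee_fin.
rewrite (le_trans (ler_distD y _ _))// lerD ?le_y//.
by rewrite distrC le_y.
Qed.

(** Regularity of uniform spaces supplies the closed set: the closure of a small
    neighbourhood of a point of [W]. *)
Lemma CLO_in_open (X : uniformType) (W : set X) :
  open W -> W !=set0 -> exists2 A, @CLO X A & A `<=` W.
Proof.
move=> oW [w Ww]; have [B wB BW] := uniform_regular (open_nbhs_nbhs (conj oW Ww)).
exists (closure B) => //; split; first exact: closed_closure.
by exists w; apply: interiorS wB; apply: subset_closure.
Qed.

(** Cliquishness is applied to the interior of [A] cut down to a ball of radius
    [e/2], which takes care of distances, and the open set it provides is then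
    shrunk to a closed one. *)
Lemma cliquish_CLO_shrink (R : realType) (X : pseudoMetricType R) (f : X -> R) :
  cliquish f -> forall (e : R) (A : set X), 0 < e -> @CLO X A ->
  exists B, [/\ @CLO X B, B `<=` A &
    forall a b, B a -> B b -> ball a e b /\ `|f a - f b| < e].
Proof.
move=> cf e A e0 [_ [a Aa]].
have e20 : 0 < e / 2 by rewrite divr_gt0.
have oW : open (A^° `&` (ball a (e / 2))^°).
  by apply: openI; apply: open_interior.
have Wa : (A^° `&` (ball a (e / 2))^°) a.
  by split=> //; apply: nbhsx_ballx.
have [U [oU U0 UW Ue]] := cf _ e oW (ex_intro _ a Wa) e0.
have [B CB BU] := CLO_in_open X U oU U0.
exists B; split=> // [x /BU/UW[/interior_subset]//|x y /BU Ux /BU Uy].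
have [[_ /interior_subset ax] [_ /interior_subset ay]] := (UW _ Ux, UW _ Uy).
split; last exact: diam_image_dist Ue Ux Uy.
exact: ball_splitr ax ay.
Qed.

(** All points from the [n]th on lie in [Q n], and so does their limit: the
    smallness of [Q n] is used first between the points, to make them Cauchy,
    and then between the points and the limit, to compare the values of [f]. *)
Lemma payoffII_shrinking (R : realType) (X : metricType R) (f : X -> R)
    (Q : nat -> set X) (x : nat -> X) :
  complete_metric X ->
  (forall n, closed (Q n)) ->
  (forall m n, (m <= n)%N -> Q n `<=` Q m) ->
  (forall n a b, Q n a -> Q n b ->
    ball a n.+1%:R^-1 b /\ `|f a - f b| < n.+1%:R^-1) ->
  (forall n, Q n (x n)) -> payoffII f x.
Proof.
move=> cX cQ decQ smallQ Qx.
have Qxm m n : (m <= n)%N -> Q m (x n) by move=> /decQ; apply.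
have small (e : R) : 0 < e -> exists n : nat, n.+1%:R^-1 < e.
  by move=> e0; have [n _ /(_ n (leqnn n))] := near_infty_natSinv_lt (PosNum e0);
     exists n.
have [|l xl] := cX x.
  apply: cauchy_exP => e /small[n ne]; exists (x n).
  exists n => // k /= nk.
  apply: le_ball (ltW ne) _ _.
  by have [] := smallQ n _ _ (Qx n) (Qxm _ _ nk).
have Ql n : Q n l.
  by apply: (closed_cvg (Q n) (cQ n) _ l xl); exists n => // k; apply: Qxm.
exists l; split=> //; apply/cvgrPdist_lt => e /small[n ne].
exists n => // k /= nk; apply: lt_trans ne.
by have [] := smallQ n _ _ (Ql n) (Qxm _ _ nk).
Qed.

Lemma cliquish_II_wins (R : realType) (X : metricType R) (f : X -> R) :
  complete_metric X -> cliquish f -> II_has_winning_strategy (@CLO X) f.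
Proof.
move=> cX cf.
(* The index [n] prescribes the size bound [1/(n+1)]. *)
have /choice[sh shP] : forall nA : nat * set X, exists B, @CLO X nA.2 ->
    [/\ @CLO X B, B `<=` nA.2 &
      forall a b, B a -> B b ->
        ball a nA.1.+1%:R^-1 b /\ `|f a - f b| < nA.1.+1%:R^-1].
  move=> -[n A] /=.
  have [CA|nCA] := pselect (@CLO X A); last by exists A.
  have n0 : 0 < n.+1%:R^-1 :> R by rewrite invr_gt0.
  by have [B BP] := cliquish_CLO_shrink R X f cf _ A n0 CA; exists B.
pose Q P := fix Q n := sh (n, if n is m.+1 then Q m else P).
exists (fun P s => Q P (size s)) => P x CP /=.
have QCLO n : @CLO X (Q P n).
  by elim: n => [|n /(shP (n.+1, Q P n))[]//]; case: (shP (0%N, P) CP).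
have QS n : Q P n.+1 `<=` Q P n by case: (shP (n.+1, Q P n) (QCLO n)).
have decQ m n : (m <= n)%N -> Q P n `<=` Q P m.
  apply: (@homo_leq _ _ (fun A B => B `<=` A)) => [A|B A C BA CB|//].
    exact: subset_refl.
  exact: subset_trans CB BA.
have Q0 : Q P 0%N `<=` P by case: (shP (0%N, P) CP).
have smallQ n a b : Q P n a -> Q P n b ->
    ball a n.+1%:R^-1 b /\ `|f a - f b| < n.+1%:R^-1.
  case: n => [|n].
    by case: (shP (0%N, P) CP) => _ _; apply.
  by case: (shP (n.+1, Q P n) (QCLO n)) => _ _; apply.
have -> : (fun n => Q P (size (mkseq x n))) = Q P.
  by apply/funext => n; rewrite size_mkseq.
split=> [n _|legal].
  by split=> //; apply: subset_trans (decQ _ _ (leq0n n)) Q0.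
by apply: (payoffII_shrinking R X f (Q P)) => // n; case: (QCLO n).
Qed.

(** A convergent sequence of values has small consecutive differences, so jumps
    bounded away from [0] are enough to make Player II lose. *)
Lemma payoffII_steps_small (R : realType) (X : topologicalType) (f : X -> R)
    (x : nat -> X) (e : R) :
  0 < e -> payoffII f x -> exists n, `|f (x n.+1) - f (x n)| < e.
Proof.
move=> e0 [l [_ /cvgrPdist_lt/(_ (e / 2))]].
rewrite divr_gt0// => /(_ isT)[n _ fx]; exists n.
have := fx n.+1 (leqnSn n); have := fx n (leqnn n) => /= fn fSn.
rewrite (le_lt_trans (ler_distD (f l) _ _))// (splitr e) ltrD//.
by rewrite distrC.
Qed.

Lemma not_cliquish_I_wins (R : realType) (X : uniformType) (f : X -> R) :
  ~ cliquish f -> I_has_winning_strategy (@CLO X) f.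
Proof.
move=> ncf.
have [W [e [oW W0 e0 oscW]]] : exists (W : set X) (e : R),
    [/\ open W, W !=set0, 0 < e &
      forall U, open U -> U !=set0 -> U `<=` W ->
        ~ (diam (f @` U) < e%:E)%E].
  apply: contrapT => nW; apply: ncf => W e oW W0 e0.
  apply: contrapT => nU; apply: nW; exists W, e; split=> // U oU U0 UW Ue.
  by apply: nU; exists U.
have [P CP PW] := CLO_in_open X W oW W0.
have [x0 _] := W0.
(* The argument of [pick] is the previous point together with the last move of
   Player II; its value is only meaningful for legal moves. *)
have /choice[pick pickP] : forall yA : X * set X, exists a, @CLO X yA.2 ->
    yA.2 `<=` P -> yA.2 a /\ e / 3 < `|f a - f yA.1|.
  move=> -[y A] /=.
  have [[CA AP]|nA] := pselect (@CLO X A /\ A `<=` P); last first.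
    by exists x0 => CA AP; exfalso; apply: nA.
  (* The interior of [A] is an open subset of [W], while [A] need not be open. *)
  have [a Aa fa] : exists2 a, A^° a & e / 3 < `|f a - f y|.
    apply: oscillation_far_value => //; apply: oscW.
    - exact: open_interior.
    - by case: CA.
    - by apply: subset_trans PW; apply: subset_trans AP; apply: interior_subset.
  by exists a => _ _; split=> //; apply: interior_subset.
exists P, (foldl (fun y A => pick (y, A)) x0); split=> // Q /=.
set x := fun n => foldl _ x0 (mkseq Q n.+1).
have xS n : x n.+1 = pick (x n, Q n.+1) by rewrite /x mkseqS foldl_rcons.
split=> [n legal|legal /(payoffII_steps_small _ _ _ _ (e / 3))[|n]].
- have [CQ QP] := legal n (leqnn n).
  rewrite /legalI; case: n CQ QP {legal} => [|n] CQ QP.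
    by have [] := pickP (x0, Q 0%N) CQ QP.
  by have := pickP (x n, Q n.+1) CQ QP; rewrite -xS => -[].
- by rewrite divr_gt0.
- have [CQ QP] := legal n.+1.
  have [_] := pickP (x n, Q n.+1) CQ QP; rewrite -xS /= => far near.
  by have := lt_trans far near; rewrite ltxx.
Qed.

Theorem corollary5p2 (R : realType) (X : metricType R)
  (X_nonempty : [set: X] !=set0) (X_complete : complete_metric X)
  (f : X -> R) :
  [/\ determined (@CLO X) f,
      cliquish f -> II_has_winning_strategy (@CLO X) f
    & ~ cliquish f -> I_has_winning_strategy (@CLO X) f].
Proof.
have II_wins := cliquish_II_wins R X f X_complete.
have I_wins := not_cliquish_I_wins R X f.
split=> //; have [cf|ncf] := pselect (cliquish f).
- by right; apply: II_wins.
- by left; apply: I_wins.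
Qed.
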